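(* Let $H, K$ be Hilbert spaces and let $T$ be a closed linear relation from $H$ into $K$. Then $T$ is Hyers-Ulam stable if and only if its range $R(T)$ is closed in $K$.
   Context: $H, K$ are real or complex Hilbert spaces (over the same field). A linear relation $T$ from $H$ into $K$ is a linear subspace of $H\times K$; its elements are written $\{h,k\}$. It is closed if it is a closed subspace of $H\times K$. $D(T)=\{h: \{h,k\}\in T \text{ for some } k\}$ is the domain and $R(T)=\{k\in K: \{h,k\}\in T \text{ for some } h\in H\}$ is the range. A linear relation $T$ between normed linear spaces $X$ and $Y$ is Hyers-Ulam stable if there is a constant $M\ge 0$ such that for any $y\in R(T)$, $\varepsilon\ge 0$ and $y_0\in R(T)$ with $\|y-y_0\|\le\varepsilon$, there exist $\{x,y\}\in T$ and $\{x_0,y_0\}\in T$ such that $\|x-x_0\|\le M\varepsilon$. *)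

(* Defs.v *)
From HB Require Import structures.
From mathcomp Require Import all_boot all_order all_algebra.
From mathcomp Require Import complex.
From mathcomp Require Import all_classical all_reals all_analysis.

Set Implicit Arguments.
Unset Strict Implicit.
Unset Printing Implicit Defensive.

Import Order.TTheory GRing.Theory Num.Theory.
Import numFieldNormedType.Exports.

Local Open Scope classical_set_scope.
Local Open Scope ring_scope.

(* The pairs (scalar field, conjugation) over which Hilbert spaces are
   considered: the reals with the identity, and the complex numbers with
   complex conjugation. *)
Variant real_or_complex (R : realType) : forall F : numFieldType, (F -> F) -> Prop :=
  | RealScalars : @real_or_complex R R idfun
  | ComplexScalars : @real_or_complex R R[i] Num.conj.

(* The norm of a normed module over F takes its values in F (for F = R[i], in
   the nonnegative reals, since 0 <= z there forces z to be real). *)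
HB.mixin Record CompleteNormedModule_isHilbert (F : numFieldType)
    (conj : F -> F) H of CompleteNormedModule F H := {
  hdot : {dot H for conj};
  hdot_norm : forall x : H, `|x| ^+ 2 = hdot x x
}.

#[short(type="hilbertType")]
HB.structure Definition Hilbert (F : numFieldType) (conj : F -> F) :=
  {H of CompleteNormedModule_isHilbert F conj H & CompleteNormedModule F H}.

Definition linear_relation (F : numFieldType) (X Y : lmodType F)
    (T : set (X * Y)) : Prop :=
  T 0 /\ forall (a : F) (u v : X * Y), T u -> T v -> T (a *: u + v).

(* [T.`2] is the range [set y | exists x, T (x, y)]. M and e live in F, where
   being nonnegative includes being real. *)
Definition hyers_ulam_stable (F : numFieldType) (X Y : normedModType F)
    (T : set (X * Y)) : Prop :=
  exists2 M : F, 0 <= M &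
    forall (y : Y) (e : F) (y0 : Y),
      T.`2 y -> 0 <= e -> T.`2 y0 -> `|y - y0| <= e ->
      exists x x0 : X, [/\ T (x, y), T (x0, y0) & `|x - x0| <= M * e].

(* Main.v *)
(* By linearity, Hyers-Ulam stability amounts to solving T(x, y) with
   |x| <= M |y| for every y in the range.  If this is possible, a point of the
   closure of the range is solvable approximately, with error again in the
   closure; summing the geometric series of successive corrections and using
   that T is closed gives an exact solution, so the range is closed.
   Conversely, if the range is closed then it is complete, and Baire's argument
   with nested balls shows that the images of the balls of radius n are dense in
   some ball of the range; by linearity this gives approximate solutions with a
   linear bound, which the same summation turns into exact ones. *)
Require Import Defs.
From HB Require Import structures.
From mathcomp Require Import all_boot all_order all_algebra.
From mathcomp Require Import complex.
From mathcomp Require Import all_classical all_reals all_analysis.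
From mathcomp Require Import ring.
Import numFieldNormedType.Exports.
Import Order.TTheory GRing.Theory Num.Theory.
Local Open Scope classical_set_scope.
Local Open Scope ring_scope.

(** The two scalar fields are told apart only here. In [R[i]] the norm of [x] is the image of a real
    number, which the Archimedean property of [R] bounds. *)
Lemma real_or_complex_archi {R : realType} {F : numFieldType} {conj : F -> F} :
  real_or_complex R conj -> Num.archimedean_axiom F.
Proof.
case=> x; first by exists (Num.bound `|x|); exact: archi_boundP.
exists (Num.bound (complex.Re `|x|)).
have x_real : ((complex.Re `|x|)%:C)%C = `|x| by rewrite RRe_real ?normr_real.
rewrite -[ltLHS]x_real -(rmorph_nat (real_complex R)) ltcR archi_boundP//.
by rewrite -lecR x_real; exact: normr_ge0.
Qed.

Lemma archi_geometric {F : numFieldType} (archiF : Num.archimedean_axiom F)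
    {c e : F} : 0 <= c -> 0 < e -> exists n, c / 2 ^+ n < e.
Proof.
move=> c0 e0; have [n cn] := archiF (c / e).
exists n; rewrite ltr_pdivrMr ?exprn_gt0// mulrC -ltr_pdivrMr//.
rewrite -(ger0_norm (divr_ge0 c0 (ltW e0))) (lt_trans cn)//.
by rewrite -natrX ltr_nat ltn_expl.
Qed.

(** The step bounds telescope, so [r n] dominates all the movement after [n]. Later [r] is first the
    remainder of a geometric series, then the radii of nested balls. *)
Lemma cvg_controlled {F : numFieldType} (archiF : Num.archimedean_axiom F)
    {V : completeNormedModType F} {u : nat -> V} {r : nat -> F} {c : F} :
  (forall n, 0 <= r n <= c / 2 ^+ n) ->
  (forall n, `|u n.+1 - u n| <= r n - r n.+1) ->
  exists2 l : V, u @ \oo --> l & forall n, `|l - u n| <= r n.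
Proof.
move=> r_bnd u_step.
have r_dist k n : `|u (n + k)%N - u n| <= r n - r (n + k)%N.
  elim: k => [|k IHk]; first by rewrite addn0 !subrr normr0.
  rewrite addnS -(subrKA (u (n + k)%N)) (le_trans (ler_normD _ _))//.
  apply: le_trans (lerD (u_step _) IHk) _.
  by rewrite [leLHS]addrC subrKA.
have u_dist m n : (n <= m)%N -> `|u m - u n| <= r n.
  move=> /subnKC <-; apply: le_trans (r_dist _ _) _.
  by rewrite lerBlDr lerDl; case/andP: (r_bnd (n + (m - n))%N).
have [l ul] : exists l : V, u @ \oo --> l.
  apply/cvg_ex/cauchy_cvgP/cauchyP => e e0.
  have c0 : 0 <= c.
    by case/andP: (r_bnd 0%N) => r0 /(le_trans r0); rewrite expr0 divr1.
  have [n ne] := archi_geometric archiF c0 e0.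
  exists (u n); exists n => // m nm /=.
  rewrite -ball_normE /= distrC.
  apply: le_lt_trans (u_dist _ _ nm) _.
  by apply: le_lt_trans ne; case/andP: (r_bnd n).
exists l => // n.
have r_ge0 : 0 <= r n by case/andP: (r_bnd n).
(* The order of [F] is partial; the two sides are comparable because both are real. A strict excess
   would contradict [u_dist] at an index close to the limit. *)
case: (real_leP (normr_real (l - u n)) (ger0_real r_ge0)) => // lt_r.
move/cvgrPdist_lt: ul => /(_ (`|l - u n| - r n)).
rewrite subr_gt0 => /(_ lt_r) [N _ uN].
have /= := uN _ (leq_maxl N n).
rewrite ltrBrDr => /(le_lt_trans _); move=> /(_ `|l - u n|).
rewrite ltxx; apply.
rewrite -(subrKA (u (maxn N n)) l) (le_trans (ler_normD _ _))//.
by rewrite lerD2l u_dist// leq_maxr.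
Qed.

Lemma linear_relationD {F : numFieldType} {X Y : lmodType F} {T : set (X * Y)} :
  linear_relation T -> forall {p q}, T p -> T q -> T (p + q).
Proof. by move=> [_ TD] p q Tp Tq; rewrite -[p]scale1r; exact: TD. Qed.

Lemma linear_relationZ {F : numFieldType} {X Y : lmodType F} {T : set (X * Y)} :
  linear_relation T -> forall a {p}, T p -> T (a *: p).
Proof. by move=> [T0 TD] a p Tp; rewrite -[_ *: p]addr0; exact: TD. Qed.

Lemma linear_relationB {F : numFieldType} {X Y : lmodType F} {T : set (X * Y)} :
  linear_relation T -> forall {p q}, T p -> T q -> T (p - q).
Proof.
move=> T_lin p q Tp Tq; rewrite -scaleN1r.
exact/linear_relationD/linear_relationZ.
Qed.

Lemma linear_range0 {F : numFieldType} {X Y : lmodType F} {T : set (X * Y)} :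
  linear_relation T -> T.`2 0.
Proof. by case=> T0 _; exists 0. Qed.

Lemma linear_rangeD {F : numFieldType} {X Y : lmodType F} {T : set (X * Y)} :
  linear_relation T -> forall y z, T.`2 y -> T.`2 z -> T.`2 (y + z).
Proof.
move=> T_lin y z [x Tx] [w Tw]; exists (x + w).
exact: (linear_relationD T_lin Tx Tw).
Qed.

Lemma linear_rangeZ {F : numFieldType} {X Y : lmodType F} {T : set (X * Y)} :
  linear_relation T -> forall a y, T.`2 y -> T.`2 (a *: y).
Proof.
move=> T_lin a y [x Tx]; exists (a *: x).
exact: (linear_relationZ T_lin a Tx).
Qed.

Lemma linear_rangeB {F : numFieldType} {X Y : lmodType F} {T : set (X * Y)} :
  linear_relation T -> forall y z, T.`2 y -> T.`2 z -> T.`2 (y - z).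
Proof.
move=> T_lin y z [x Tx] [w Tw]; exists (x - w).
exact: (linear_relationB T_lin Tx Tw).
Qed.

Lemma closure_normP {F : numFieldType} {V : normedModType F} (A : set V) (y : V) :
  closure A y <-> forall e, 0 < e -> exists2 z, A z & `|y - z| < e.
Proof.
split=> [Ay e e0|Ay B /nbhs_ballP[e /= e0 eB]].
  have [z [Az]] := Ay _ (nbhsx_ballx y e e0).
  by rewrite -ball_normE /= => yz; exists z.
have [z Az yz] := Ay e e0.
by exists z; split=> //; apply: eB; rewrite -ball_normE.
Qed.

(* The invariant is that the error of each approximate solution is again in E,
   so that it can be corrected in turn; the corrections form a geometric
   series. *)
Lemma approx_solvable {F : numFieldType} (archiF : Num.archimedean_axiom F)
    {X Y : completeNormedModType F} {T : set (X * Y)} {E : set Y} {C : F} :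
  linear_relation T -> closed T -> 0 <= C ->
  (forall y z, E y -> T.`2 z -> E (y - z)) ->
  (forall y e, E y -> 0 < e ->
    exists x z, [/\ T (x, z), `|x| <= C * `|y| & `|y - z| <= e]) ->
  forall y, E y -> exists2 x, T (x, y) & `|x| <= 2 * C * `|y|.
Proof.
move=> T_lin T_closed C0 EB Eapprox y Ey.
have [->|y_neq0] := eqVneq y 0.
  by exists 0; [case: T_lin | rewrite !normr0 mulr0].
have d_gt0 : 0 < `|y| by rewrite normr_gt0.
set d := `|y| in d_gt0 *.
have e_gt0 n : 0 < d / 2 ^+ n by rewrite divr_gt0// exprn_gt0.
(* [g] picks a correction for the error [nz.2] at stage [nz.1]; outside [E] nothing is asked of
   it. *)
have /choice[g gP] : forall nz : nat * Y, exists p : X * Y, E nz.2 ->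
    [/\ T p, `|p.1| <= C * `|nz.2| & `|nz.2 - p.2| <= d / 2 ^+ nz.1.+1].
  move=> [n z] /=; have [Ez|nEz] := pselect (E z); last by exists 0.
  by have [x [w Txw]] := Eapprox z _ Ez (e_gt0 n.+1); exists (x, w).
pose p := fix p n : X * Y :=
  if n is m.+1 then p m + g (m, y - (p m).2) else 0.
have pP n : T (p n) /\ `|y - (p n).2| <= d / 2 ^+ n.
  elim: n => [|n [Tp yp]] /=.
    by split; [case: T_lin | rewrite subr0 expr0 divr1].
  have /gP[Tg _ yg] : E (n, y - (p n).2).2.
    by apply: EB => //; exists (p n).1; rewrite -surjective_pairing.
  by split; [exact: linear_relationD | rewrite opprD addrA].
have Ep n : E (y - (p n).2).
  by apply: EB => //; exists (p n).1; rewrite -surjective_pairing; case: (pP n).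
(* The correction at stage [n] has norm at most [C * (d / 2 ^+ n)], and [r n] is the sum of these
   bounds from [n] on. Since [p 0] is [0], [r 0] bounds the solution. *)
have [|n|x px xp] :=
    cvg_controlled archiF (u := fst \o p) (r := fun n => 2 * C * d / 2 ^+ n)
      (c := 2 * C * d).
- by move=> n; rewrite lexx andbT divr_ge0// ?exprn_ge0// !mulr_ge0// ltW.
- rewrite /= addrAC subrr add0r.
  have [_ + _] := gP (n, y - (p n).2) (Ep n) => /= /le_trans; apply.
  have -> : 2 * C * d / 2 ^+ n - 2 * C * d / 2 ^+ n.+1 = C * (d / 2 ^+ n).
    by rewrite exprS; field; rewrite expf_neq0 ?pnatr_eq0.
  by rewrite ler_wpM2l//; case: (pP n).
have py : (snd \o p) @ \oo --> y.
  apply/cvgrPdist_lt => e e0; have [n ne] := archi_geometric archiF (ltW d_gt0) e0.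
  exists n => // m /= nm; apply: le_lt_trans ne.
  apply: le_trans (pP m).2 _.
  apply: ler_wpM2l; first exact: ltW.
  by rewrite lef_pV2 ?posrE ?exprn_gt0 // ler_eXn2l ?ltr1n.
exists x; last by have := xp 0%N; rewrite /= subr0 expr0 divr1.
have pxy : ((p n).1, (p n).2) @[n --> \oo] --> (x, y) by exact: cvg_pair px py.
apply: (closed_cvg T T_closed _ _ pxy).
by apply: nearW => n /=; rewrite -surjective_pairing; case: (pP n).
Qed.

(** If no [A n] were dense in a ball of [B], every closed ball centred in [B] would contain a
    smaller one, again centred in [B], that misses [A n]. The limit of the centres would lie in [B]
    but in no [A n]. *)
Lemma baire_closed {F : numFieldType} (archiF : Num.archimedean_axiom F)
    {V : completeNormedModType F} {B : set V} {A : nat -> set V} :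
  closed B -> B !=set0 -> (forall y, B y -> exists n, A n y) ->
  exists n y0 r, [/\ B y0, 0 < r & forall y, B y -> `|y - y0| < r ->
    forall e, 0 < e -> exists2 z, A n z & `|y - z| < e].
Proof.
move=> B_closed [b Bb] AB; apply: contrapT => no_ball.
have /choice[g gP] : forall t : nat * (V * F), exists q : V * F,
    B t.2.1 -> 0 < t.2.2 ->
    [/\ B q.1, 0 < q.2, q.2 <= t.2.2 / 2, `|q.1 - t.2.1| <= t.2.2 / 2
      & forall z, A t.1 z -> ~ `|z - q.1| <= q.2].
  move=> [n [y0 r]] /=.
  have [By0|nBy0] := pselect (B y0); last by exists (y0, r).
  have [r0|nr0] := pselect (0 < r); last by exists (y0, r).
  (* Density is denied on the ball of radius [r / 2], so that the shift of the centre and the new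
     radius each use up at most half of [r]. *)
  apply: contrapT => noq; apply: no_ball; exists n, y0, (r / 2).
  have r20 : 0 < r / 2 by rewrite divr_gt0.
  split=> // y By yy0 e e0; apply: contrapT => noz; apply: noq.
  (* [s] is the smaller of [r / 2] and [e / 2]; halving [e] puts the closed ball of radius [s]
     inside the open one of radius [e], which misses [A n]. *)
  have [s [s0 sr se]] : exists s, [/\ 0 < s, s <= r / 2 & s < e].
    have e20 : 0 < e / 2 by rewrite divr_gt0.
    have e2e : e / 2 < e by rewrite gtr_pMr// invf_lt1 ?ltr1n.
    case: (real_leP (gtr0_real r20) (gtr0_real e20)) => le_re.
      by exists (r / 2); split=> //; exact: le_lt_trans e2e.
    by exists (e / 2); split=> //; exact: ltW.
  exists (y, s) => _ _; split=> //=; first exact: ltW.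
  move=> z Az zy; apply: noz; exists z => //.
  by rewrite distrC; exact: le_lt_trans se.
pose q := fix q n : V * F := if n is m.+1 then g (m, q m) else (b, 1).
have qP n : [/\ B (q n).1, 0 < (q n).2 & (q n).2 <= 1 / 2 ^+ n].
  elim: n => [|n [Bq q0 qn]] /=; first by rewrite expr0 divr1.
  have [? ? qr _ _] := gP (n, q n) Bq q0.
  split=> //; apply: le_trans qr _ => /=.
  by rewrite exprSr invfM mulrA ler_wpM2r.
have gqP n := let: And3 Bq q0 _ := qP n in gP (n, q n) Bq q0.
have [n|n|l ql lq] :=
    cvg_controlled archiF (u := fst \o q) (r := snd \o q) (c := 1).
- by have [_ q0 ->] := qP n; rewrite /= ltW.
- have [_ _ /= qr qd _] := gqP n.
  apply: le_trans qd _ => /=.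
  rewrite lerBrDr -lerBrDl; apply: le_trans qr _.
  by rewrite lerBrDr -splitr.
have Bl : B l.
  apply: (closed_cvg _ B_closed _ _ ql).
  by apply: nearW => n /=; case: (qP n).
have [n Anl] := AB l Bl.
(* The ball numbered [n.+1] was chosen to miss [A n], yet it contains [l]. *)
by have [_ _ _ _ /(_ l Anl)] := gqP n; apply; exact: lq n.+1.
Qed.

(** Some [A n] is dense in a ball of the range about [y0]. For small [t], both [t *: y + y0] and
    [y0] lie in it; the difference of their approximations, divided by [t], approximates [y]. *)
Lemma closed_range_approx {F : numFieldType} (archiF : Num.archimedean_axiom F)
    {X Y : completeNormedModType F} {T : set (X * Y)} :
  linear_relation T -> closed T.`2 ->
  exists2 C, 0 <= C & forall y e, T.`2 y -> 0 < e ->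
    exists x z, [/\ T (x, z), `|x| <= C * `|y| & `|y - z| <= e].
Proof.
move=> T_lin R_closed.
pose A n : set Y := [set y | exists2 x, T (x, y) & `|x| <= n%:R].
have [|y [x Tx]|n [y0 [r [Ry0 r0 Ar]]]] :=
    baire_closed archiF (A := A) R_closed.
- by exists 0; exact: linear_range0.
- have [n] := archiF `|x|; rewrite normr_id => xn.
  by exists n, x => //; exact: ltW.
(* The constant bounds the difference of two vectors of norm at most [n%:R], scaled by the inverse
   of the [t] below. *)
exists (4 * n%:R / r); first by rewrite divr_ge0 ?mulr_ge0// ltW.
move=> y e Ry e0; have [->|y_neq0] := eqVneq y 0.
  exists 0, 0; split; first by case: T_lin.
    by rewrite !normr0 mulr0.
  by rewrite subrr normr0 ltW.
have d0 : 0 < `|y| by rewrite normr_gt0.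
(* This makes the norm of [t *: y] equal to [r / 2]. *)
pose t := r / (2 * `|y|).
have t0 : 0 < t by rewrite divr_gt0 ?mulr_gt0.
(* Two errors of this size add up to [t * e], hence to [e] after division by [t]. *)
have te0 : 0 < t * e / 2 by apply: divr_gt0 => //; exact: mulr_gt0.
have [||a [xa Ta xan] ya] := Ar (t *: y + y0) _ _ _ te0.
- by apply: linear_rangeD => //; exact: linear_rangeZ.
- rewrite addrK normrZ gtr0_norm//.
  have -> : t * `|y| = r / 2 by rewrite /t; field; rewrite gt_eqF.
  by rewrite gtr_pMr// invf_lt1 ?ltr1n.
have [||b [xb Tb xbn] yb] := Ar y0 _ _ _ te0 => //.
  by rewrite subrr normr0.
exists (t^-1 *: (xa - xb)), (t^-1 *: (a - b)); split.
- exact: (linear_relationZ T_lin t^-1 (linear_relationB T_lin Ta Tb)).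
- rewrite normrZ gtr0_norm ?invr_gt0//.
  have -> : 4 * n%:R / r * `|y| = t^-1 * (n%:R + n%:R).
    by rewrite /t; field; rewrite !gt_eqF.
  apply: ler_wpM2l; first by rewrite invr_ge0 ltW.
  by apply: le_trans (ler_normB _ _) _; exact: lerD.
have -> : y - t^-1 *: (a - b) = t^-1 *: ((t *: y + y0 - a) - (y0 - b)).
  rewrite [t *: y + y0 - a]addrAC addrKA opprK -addrA [- a + b]addrC -[b - a]opprB.
  by rewrite [RHS]scalerBr scalerA mulVf ?gt_eqF// scale1r.
rewrite normrZ gtr0_norm ?invr_gt0// ler_pdivrMl//.
apply: le_trans (ler_normB _ _) _; rewrite [leRHS]splitr.
by apply: lerD; exact: ltW.
Qed.

Lemma hyers_ulam_solvable {F : numFieldType} {X Y : normedModType F}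
    (T : set (X * Y)) : linear_relation T ->
  hyers_ulam_stable T <->
  exists2 M, 0 <= M & forall y, T.`2 y -> exists2 x, T (x, y) & `|x| <= M * `|y|.
Proof.
move=> T_lin; split=> -[M M0 TM]; exists M => //.
  move=> y Ry.
  have [|x [x0 [Tx Tx0 xM]]] :=
    TM y `|y| 0 Ry (normr_ge0 y) (linear_range0 T_lin).
    by rewrite subr0.
  (* [T] may relate a nonzero [x0] to [0]; subtracting it leaves the image [y] unchanged. *)
  exists (x - x0) => //.
  have := linear_relationB T_lin Tx Tx0.
  by rewrite (_ : (_, _) - _ = (x - x0, y))//; congr pair; rewrite subr0.
move=> y e y0 Ry e0 [x0 Tx0] ye.
have [|x Tx xM] := TM (y - y0); first by apply: linear_rangeB => //; exists x0.
exists (x + x0), x0; split => //.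
  have := linear_relationD T_lin Tx Tx0.
  by rewrite (_ : (_, _) + _ = (x + x0, y))//; congr pair; rewrite subrK.
by rewrite addrK (le_trans xM)// ler_wpM2l.
Qed.

Theorem theorem3p3 (R : realType) (F : numFieldType) (conj : F -> F)
    (hF : real_or_complex R conj) (H K : hilbertType conj)
    (T : set (H * K)) (T_lin : linear_relation T) (T_closed : closed T) :
  hyers_ulam_stable T <-> closed T.`2.
Proof.
have archiF := real_or_complex_archi hF.
rewrite hyers_ulam_solvable//; split=> [[M M0 TM]|R_closed].
  have RB y z : closure T.`2 y -> T.`2 z -> closure T.`2 (y - z).
    move=> /closure_normP Ry Rz; apply/closure_normP => e /Ry[w Rw yw].
    exists (w - z); first exact: linear_rangeB.
    by rewrite opprB addrA subrK.
  (* With the closure of the range as [E], [approx_solvable] then gives an exact solution at each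
     point of the closure, which is therefore in the range. *)
  suff Rapprox y e : closure T.`2 y -> 0 < e ->
      exists x z, [/\ T (x, z), `|x| <= 2 * M * `|y| & `|y - z| <= e].
    have M20 : 0 <= 2 * M by rewrite mulr_ge0.
    move=> y /(approx_solvable archiF T_lin T_closed M20 RB Rapprox).
    by case=> x Tx _; exists x.
  move=> Ry e0; have [->|y_neq0] := eqVneq y 0.
    by exists 0, 0; split; [case: T_lin | rewrite !normr0 mulr0
      | rewrite subrr normr0 ltW].
  have d0 : 0 < `|y| by rewrite normr_gt0.
  (* A point of the range within [s] of [y] has at most twice the norm of [y], whence the factor [2]
     in the bound. *)
  have [s [s0 sd se]] : exists s, [/\ 0 < s, s <= `|y| & s <= e].
    case: (real_leP (gtr0_real d0) (gtr0_real e0)) => le_de.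
      by exists `|y|.
    by exists e; split=> //; exact: ltW.
  have [z Rz yz] := (closure_normP _ _).1 Ry s s0.
  have [x Txz xz] := TM z Rz.
  exists x, z; split=> //; last exact: le_trans (ltW yz) se.
  apply: le_trans xz _; rewrite [2 * M]mulrC -mulrA ler_wpM2l//.
  rewrite -(subKr y z) (le_trans (ler_normB _ _))// mulr_natl mulr2n lerD2l.
  exact: le_trans (ltW yz) sd.
have [C C0 TC] := closed_range_approx archiF T_lin R_closed.
exists (2 * C); first by rewrite mulr_ge0.
exact: (approx_solvable archiF T_lin T_closed C0 (linear_rangeB T_lin) TC).
Qed.
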